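(* There is a universal constant $c_0>0$ such that the following holds. Let $M\in\mathbb{R}^p$ and let $T_{\mathcal{A}}(M)$ be the local tangent cone at $M$. In the linear inverse model $Y=\mathcal{X}(M')+Z$ with linear operator $\mathcal{X}:\mathbb{R}^p\to\mathbb{R}^n$, noise $Z\sim N(0,\frac{\sigma^2}{n}I_n)$ and parameter $M'\in T_{\mathcal{A}}(M)$, $$\inf_{\hat M}\sup_{M'\in T_{\mathcal{A}}(M)}\mathbb{E}_{\cdot|\mathcal{X}}\|\hat M-M'\|_{\ell_2}^2\ge\frac{c_0\sigma^2}{\psi_{\mathcal{A}}^2(M,\mathcal{X})}\cdot\left(\frac{e(B_2^p\cap T_{\mathcal{A}}(M))}{\sqrt n}\vee\frac{v(B_2^p\cap T_{\mathcal{A}}(M))}{\sqrt n}\right)^2,$$ where the infimum is over all measurable estimators $\hat M$ and $\mathbb{E}_{\cdot|\mathcal{X}}$ denotes expectation conditional on the design $\mathcal{X}$.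
   Context: $\mathcal{A}\subset\mathbb{R}^p$ is a compact atom set whose elements are extreme points of $\mathrm{conv}(\mathcal{A})$, with $\mathrm{conv}(\mathcal{A})$ a symmetric convex body. Atomic norm: $\|x\|_{\mathcal{A}}=\inf\{t>0:x\in t\,\mathrm{conv}(\mathcal{A})\}$. Tangent cone: $T_{\mathcal{A}}(x)=\mathrm{cone}\{h:\|x+h\|_{\mathcal{A}}\le\|x\|_{\mathcal{A}}\}$ with $\mathrm{cone}(S)=\{th:t\ge0,h\in S\}$. Local upper isometry constant: $\psi_{\mathcal{A}}(M,\mathcal{X})=\sup\{\|\mathcal{X}(h)\|_{\ell_2}/\|h\|_{\ell_2}:h\in T_{\mathcal{A}}(M),h\ne0\}$. $B_2^p$ is the closed Euclidean unit ball; $a\vee b=\max(a,b)$. Sudakov estimate: $e(K)=\sup_{\epsilon>0}\epsilon\sqrt{\log\mathcal{N}(K,\epsilon)}$, where $\mathcal{N}(K,\epsilon)$ is the smallest cardinality of a set $S\subset K$ such that every $x\in K$ has some $y\in S$ with $\|x-y\|_{\ell_2}<\epsilon$. Volume ratio: $v(K)=\sqrt p\left(\mathrm{vol}(K)/\mathrm{vol}(B_2^p)\right)^{1/p}$. *)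

(* Defs.v *)
(* R^p is ['rV[R]_p] (row vectors), with the topology of the library. *)
From HB Require Import structures.
From mathcomp Require Import all_boot all_order all_algebra.
From mathcomp Require Import all_classical all_reals all_analysis.

Set Implicit Arguments.
Unset Strict Implicit.
Unset Printing Implicit Defensive.
Import Order.TTheory GRing.Theory Num.Theory numFieldNormedType.Exports.

Local Open Scope classical_set_scope.
Local Open Scope ring_scope.

(* The Borel sigma-algebra of R^n, generated by the coordinates, as in the
   library's instance on [n.-tuple]. *)
Section measurable_rV.
Context {R : realType}.
Variable n : nat.

Let coords : 'I_n -> 'rV[R]_n -> R := fun i x => x ord0 i.

Let rV_set0 : g_sigma_preimage coords set0.
Proof. exact: sigma_algebra0. Qed.

Let rV_setC A : g_sigma_preimage coords A -> g_sigma_preimage coords (~` A).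
Proof. exact: sigma_algebraC. Qed.

Let rV_bigcup (F : _^nat) : (forall i, g_sigma_preimage coords (F i)) ->
  g_sigma_preimage coords (\bigcup_i (F i)).
Proof. exact: sigma_algebra_bigcup. Qed.

HB.instance Definition _ := @isMeasurable.Build default_measure_display
  'rV[R]_n (g_sigma_preimage coords) rV_set0 rV_setC rV_bigcup.

End measurable_rV.

(* The library's norm on ['rV[R]_p] is the sup norm. *)
Definition l2norm (R : realType) (p : nat) (x : 'rV[R]_p) : R :=
  Num.sqrt (\sum_(i < p) x ord0 i ^+ 2).

Definition l2ball (R : realType) (p : nat) : set 'rV[R]_p :=
  [set x | l2norm x <= 1].

Definition convex_hull (R : realType) (p : nat) (A : set 'rV[R]_p) :
    set 'rV[R]_p :=
  smallest (@convex_set R 'rV[R]_p) A.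

Definition extreme_point (R : realType) (p : nat) (C : set 'rV[R]_p)
    (x : 'rV[R]_p) : Prop :=
  C x /\ forall (y z : 'rV[R]_p) (t : R), C y -> C z -> 0 < t -> t < 1 ->
    x = t *: y + (1 - t) *: z -> y = x /\ z = x.

Definition symmetric_convex_body (R : realType) (p : nat)
    (K : set 'rV[R]_p) : Prop :=
  [/\ compact K, @convex_set R 'rV[R]_p K, interior K !=set0
    & forall x, K x -> K (- x)].

Definition atom_set (R : realType) (p : nat) (A : set 'rV[R]_p) : Prop :=
  [/\ compact A, forall a, A a -> extreme_point (convex_hull A) a
    & symmetric_convex_body (convex_hull A)].

Definition atomic_norm (R : realType) (p : nat) (A : set 'rV[R]_p)
    (x : 'rV[R]_p) : R :=
  inf [set t | 0 < t /\ exists2 y, convex_hull A y & x = t *: y].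

Definition cone (R : realType) (p : nat) (S : set 'rV[R]_p) : set 'rV[R]_p :=
  [set x | exists t : R, 0 <= t /\ exists2 h, S h & x = t *: h].

Definition tangent_cone (R : realType) (p : nat) (A : set 'rV[R]_p)
    (x : 'rV[R]_p) : set 'rV[R]_p :=
  cone [set h | atomic_norm A (x + h) <= atomic_norm A x].

Local Open Scope ereal_scope.

(* If the tangent cone is {0} this is [ereal_sup set0 = -oo], and then
   [(psi ^+ 2)^-1 = 0]; if the operator vanishes on a nonzero cone then
   [psi = 0] and [(psi ^+ 2)^-1 = +oo]. *)
Definition local_upper_isometry (R : realType) (p n : nat) (A : set 'rV[R]_p)
    (M : 'rV[R]_p) (X : {linear 'rV[R]_p -> 'rV[R]_n}) : \bar R :=
  ereal_sup [set (l2norm (X h) / l2norm h)%:E |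
              h in [set h | tangent_cone A M h /\ h != 0%R]].

(* [counting S] is the cardinality of S, +oo if S is infinite. *)
Definition covering_number (R : realType) (p : nat) (K : set 'rV[R]_p)
    (eps : R) : \bar R :=
  ereal_inf [set counting S | S in [set S : set 'rV[R]_p | S `<=` K /\
    forall x, K x -> exists2 y, S y & (l2norm (x - y) < eps)%R]].

Definition sudakov_estimate (R : realType) (p : nat) (K : set 'rV[R]_p) :
    \bar R :=
  ereal_sup [set eps%:E * sqrte (lne (covering_number K eps)) |
              eps in [set eps : R | (0 < eps)%R]].

Definition box (R : realType) (p : nat) (b : 'rV[R]_p * 'rV[R]_p) :
    set 'rV[R]_p :=
  [set x | forall i, (b.1 ord0 i <= x ord0 i <= b.2 ord0 i)%R].

(* A box with [b.2 ord0 i < b.1 ord0 i] for some [i] is empty, hence the max. *)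
Definition box_volume (R : realType) (p : nat) (b : 'rV[R]_p * 'rV[R]_p) : R :=
  (\prod_(i < p) Num.max 0 (b.2 ord0 i - b.1 ord0 i))%R.

(* p-dimensional Lebesgue (outer) measure: the infimum of the total volumes of
   the countable covers by boxes.  On Lebesgue-measurable sets, in particular
   on convex sets, it is the Lebesgue measure. *)
Definition volume (R : realType) (p : nat) (K : set 'rV[R]_p) : \bar R :=
  ereal_inf [set \sum_(0 <= k <oo) (box_volume (b k))%:E |
    b in [set b : nat -> 'rV[R]_p * 'rV[R]_p |
          K `<=` \bigcup_k box (b k)]].

Definition volume_ratio (R : realType) (p : nat) (K : set 'rV[R]_p) : \bar R :=
  (Num.sqrt p%:R)%:E * (volume K / volume (@l2ball R p)) `^ (p%:R^-1).

(* Z ~ N(0, s^2 I_n): the law of Z is the n-fold product of N(0, s^2); the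
   second argument of [normal_prob] is the standard deviation. *)
Definition isotropic_gaussian (R : realType) (n : nat) (d : measure_display)
    (Omega : measurableType d) (P : probability Omega R) (s : R)
    (Z : Omega -> 'rV[R]_n) : Prop :=
  measurable_fun [set: Omega] Z /\
  forall B : 'I_n -> set R, (forall i, measurable (B i)) ->
    P [set w | forall i, B i (Z w ord0 i)] =
    \prod_(i < n) normal_prob 0%R s (B i).

(* The design X is fixed, i.e. the expectation is conditional on X; estimators
   are measurable functions of Y = X(M') + Z, and may depend on X, A and M. *)
Definition minimax_risk (R : realType) (p n : nat) (d : measure_display)
    (Omega : measurableType d) (P : probability Omega R)
    (X : {linear 'rV[R]_p -> 'rV[R]_n}) (Z : Omega -> 'rV[R]_n)
    (T : set 'rV[R]_p) : \bar R :=
  ereal_inf [set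
    ereal_sup [set 'E_P[fun w => (l2norm (Mhat (X M' + Z w) - M') ^+ 2)%R] |
                M' in T] |
    Mhat in [set Mhat : 'rV[R]_n -> 'rV[R]_p |
              measurable_fun [set: 'rV[R]_n] Mhat]].

(* Main.v *)
(* Lower bound by a packing argument. The tangent cone T is stable under positive
   scalings, so an eps-separated family of m points of B_2 /\ T may be scaled by
   any delta > 0; its images under X then have norm at most psi * delta. If the
   events A_i ("the estimator is close to the i-th point") are disjoint, the
   likelihood ratio L_i of the law of X(theta_i) + Z with respect to that of Z
   satisfies, by AM-GM,
     P(Z + X(theta_i) in A_i) = E[1_{A_i}(Z) L_i(Z)]
       <= (l / 2) P(Z in A_i) + E[L_i(Z)^2] / (2 l),
   with E[L_i(Z)^2] = exp(|X(theta_i)|^2 / s^2). Averaging over i, for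
   (psi delta / s)^2 = (ln m) / 2 some A_i has probability at most m^(-1/4), hence
   a risk of order (delta eps)^2 = s^2 eps^2 ln m / (2 psi^2). A maximal separated
   family is a net, which gives the Sudakov term. The volume ratio is at most
   a constant times the Sudakov estimate, by the volume bound
   N(K, eps) >= vol K / (eps^p vol B_2) at eps = (vol K / vol B_2)^(1/p) / 2. *)
Require Import Defs.
From HB Require Import structures.
From mathcomp Require Import all_boot all_order all_algebra.
From mathcomp Require Import all_classical all_reals all_analysis.
From mathcomp Require Import measurable_realfun ring.

Set Implicit Arguments.
Unset Strict Implicit.
Unset Printing Implicit Defensive.
Import Order.TTheory GRing.Theory Num.Theory numFieldNormedType.Exports.
Local Open Scope classical_set_scope.
Local Open Scope ereal_scope.

(** * Image measures with a density *)

Section weighted_law.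
Import HBNNSimple.
Local Open Scope ring_scope.
Local Open Scope ereal_scope.
Context {R : realType} {d d' : measure_display} {T : measurableType d}
  {T' : measurableType d'}.
Variables (m : {measure set T -> \bar R}) (phi : T -> T') (g : T -> R).
Hypotheses (mphi : measurable_fun [set: T] phi) (mg : measurable_fun [set: T] g)
  (g0 : forall t, (0 <= g t)%R).

(** The image under [phi] of the measure with density [g] with respect to [m], kept as a bare set
    function so that laws coming from different source spaces can be compared. *)
Definition weighted_law (A : set T') : \bar R :=
  \int[m]_t ((\1_A (phi t))%:E * (g t)%:E).

Lemma measurable_weighted (f : T' -> \bar R) : measurable_fun [set: T'] f ->
  measurable_fun [set: T] (fun t => f (phi t) * (g t)%:E).
Proof.
move=> mf; apply: emeasurable_funM; last exact/measurable_EFinP.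
exact: measurableT_comp.
Qed.

Lemma measurable_weighted_indic A : measurable A ->
  measurable_fun [set: T] (fun t => (\1_A (phi t))%:E * (g t)%:E).
Proof.
move=> mA; apply: (measurable_weighted (f := fun x => (\1_A x)%:E)).
by apply/measurable_EFinP; exact: measurable_indic.
Qed.

Lemma weighted_lawC A : measurable A ->
  weighted_law A + weighted_law (~` A) = weighted_law [set: T'].
Proof.
move=> mA; rewrite /weighted_law -ge0_integralD//.
- apply: eq_integral => t _; rewrite -ge0_muleDl ?lee_fin// -EFinD.
  by rewrite indicT !indicE in_setC; case: (_ \in A); rewrite /= ?addr0 ?add0r.
- by move=> t _; rewrite mule_ge0// lee_fin.
- exact: measurable_weighted_indic.
- by move=> t _; rewrite mule_ge0// lee_fin.
- by apply: measurable_weighted_indic; exact: measurableC.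
Qed.

Lemma weighted_law_bigcup (F : (set T')^nat) : (forall n, measurable (F n)) ->
  trivIset [set: nat] F ->
  weighted_law (\bigcup_n F n) = \sum_(n <oo) weighted_law (F n).
Proof.
move=> mF tF; rewrite /weighted_law -integral_nneseries//.
- apply: eq_integral => t _; under eq_eseriesr do rewrite muleC.
  rewrite nneseriesZl; last by move=> n _; rewrite lee_fin.
  rewrite [RHS]muleC; congr (_ * _).
  (* For fixed [t], the sum of the indicators is countable additivity of the Dirac measure at
     [phi t]. *)
  exact: (measure_semi_bigcup (\d_(phi t)) mF tF (bigcupT_measurable _ mF)).
- by move=> n; exact: measurable_weighted_indic.
- by move=> n t _; rewrite mule_ge0// lee_fin.
Qed.

(** Monotone convergence along simple functions. The point is that [m], [phi] and [g] enter the
    right-hand side only through [weighted_law], so equal weighted laws give equal integrals. *)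
Lemma weighted_integral_approx (f : T' -> \bar R) (mf : measurable_fun [set: T'] f) :
  (forall x, 0 <= f x) ->
  let f_ := nnsfun_approx measurableT mf in
  \int[m]_t (f (phi t) * (g t)%:E) =
  limn (fun n => \sum_(r \in range (f_ n)) r%:E * weighted_law (f_ n @^-1` [set r])).
Proof.
move=> f0 f_.
transitivity (limn (fun n => \int[m]_t ((f_ n (phi t))%:E * (g t)%:E))).
  rewrite -monotone_convergence//.
  - apply: eq_integral => t _; apply/esym/cvg_lim => //.
    under eq_fun do rewrite muleC.
    rewrite muleC; apply: cvgeZl => //.
    by apply: cvg_nnsfun_approx => // *; exact: f0.
  - move=> n; apply: (measurable_weighted (f := EFin \o f_ n)).
    exact/measurable_EFinP/measurable_funP.
  - by move=> n t _; rewrite mule_ge0// lee_fin.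
  - move=> t _ a b ab; rewrite lee_wpmul2r// lee_fin//.
    exact/lefP/nd_nnsfun_approx.
apply/congr_lim/funext => n.
under eq_integral => t _.
  rewrite fimfunE -fsumEFin// ge0_mule_fsuml; last first.
    by move=> r; rewrite nnfun_muleindic_ge0.
  over.
rewrite /= ge0_integral_fsum//; last 2 first.
- move=> r; apply: emeasurable_funM => //; apply/measurable_EFinP => //.
  apply: measurable_funM => //.
  have mI : measurable_fun [set: T'] (\1_(f_ n @^-1` [set r]) : T' -> R).
    exact: measurable_indic.
  exact: measurableT_comp mI mphi.
- by move=> r t _; rewrite mule_ge0 ?lee_fin// -lee_fin EFinM nnfun_muleindic_ge0.
apply: eq_fsbigr => r; rewrite inE => -[x _ <-].
rewrite -ge0_integralZl ?lee_fin//.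
- by apply: eq_integral => t _; rewrite EFinM muleA.
- by apply: measurable_weighted_indic; exact: measurable_sfunP.
- by move=> t _; rewrite mule_ge0// lee_fin.
Qed.
End weighted_law.

Section weighted_law_unique.
Import HBNNSimple.
Local Open Scope ring_scope.
Local Open Scope ereal_scope.
Context {R : realType} {d1 d2 d' : measure_display} {T1 : measurableType d1}
  {T2 : measurableType d2} {T' : measurableType d'}.
Variables (m1 : {measure set T1 -> \bar R}) (m2 : {measure set T2 -> \bar R})
  (phi1 : T1 -> T') (phi2 : T2 -> T') (g1 : T1 -> R) (g2 : T2 -> R).
Hypotheses (mphi1 : measurable_fun [set: T1] phi1)
  (mphi2 : measurable_fun [set: T2] phi2)
  (mg1 : measurable_fun [set: T1] g1) (mg2 : measurable_fun [set: T2] g2)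
  (g10 : forall t, (0 <= g1 t)%R) (g20 : forall t, (0 <= g2 t)%R).

Lemma eq_weighted_law_integral :
  (forall A, measurable A -> weighted_law m1 phi1 g1 A = weighted_law m2 phi2 g2 A) ->
  forall f : T' -> \bar R, measurable_fun [set: T'] f -> (forall x, 0 <= f x) ->
  \int[m1]_t (f (phi1 t) * (g1 t)%:E) = \int[m2]_t (f (phi2 t) * (g2 t)%:E).
Proof.
move=> m12 f mf f0; rewrite (weighted_integral_approx m1 mphi1 mg1 g10 mf f0).
rewrite (weighted_integral_approx m2 mphi2 mg2 g20 mf f0).
apply/congr_lim/funext => n; apply: eq_fsbigr => r _; rewrite m12//.
Qed.

(** A pi-lambda argument: agreement passes to complements because the common total mass is finite
    and can be cancelled, and to disjoint unions by countable additivity. *)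
Lemma weighted_law_unique (G : set (set T')) :
  @measurable _ T' = <<s G >> -> setI_closed G ->
  weighted_law m1 phi1 g1 [set: T'] = weighted_law m2 phi2 g2 [set: T'] ->
  weighted_law m1 phi1 g1 [set: T'] < +oo ->
  (forall A, G A -> weighted_law m1 phi1 g1 A = weighted_law m2 phi2 g2 A) ->
  forall A, measurable A -> weighted_law m1 phi1 g1 A = weighted_law m2 phi2 g2 A.
Proof.
move=> mG GI eT finT eG A mA.
have ge0 A' : 0 <= weighted_law m1 phi1 g1 A'.
  by apply: integral_ge0 => t _; rewrite mule_ge0// lee_fin.
apply: (@dynkin_induction _ _ G (fun A => weighted_law m1 phi1 g1 A = weighted_law m2 phi2 g2 A)) => //.
- move=> S mS eS.
  have := weighted_lawC m1 mphi1 mg1 g10 mS; have := weighted_lawC m2 mphi2 mg2 g20 mS.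
  have fS : weighted_law m1 phi1 g1 S \is a fin_num.
    rewrite ge0_fin_numE//; apply: le_lt_trans finT.
    by rewrite -(weighted_lawC m1 mphi1 mg1 g10 mS) leeDl.
  rewrite -eT -eS => <- /eqP; rewrite eq_sym addeC [eqbRHS]addeC.
  by move/eqP/(congr1 (fun x => x - weighted_law m1 phi1 g1 S)); rewrite !addeK.
- move=> F mF tF eF; rewrite !weighted_law_bigcup//.
  by apply: eq_eseriesr => n _; exact: eF.
- by rewrite -mG.
Qed.

End weighted_law_unique.

(** * Translations of a Gaussian vector *)

Section rectangles.
Local Open Scope ring_scope.
Context {R : realType} {n : nat}.

Definition rectangle (B : 'I_n -> set R) : set 'rV[R]_n :=
  [set x | forall i, B i (x ord0 i)].

Definition measurable_rectangle : set (set 'rV[R]_n) :=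
  [set rectangle B | B in [set B | forall i, measurable (B i)]].

Lemma measurable_coord (i : 'I_n) :
  measurable_fun [set: 'rV[R]_n] (fun x : 'rV[R]_n => x ord0 i).
Proof.
move=> _ Y mY; rewrite setTI; apply: sub_sigma_algebra => /=.
rewrite -bigcup_seq/=; exists i => /=; first by rewrite mem_index_enum.
by exists Y => //; rewrite setTI.
Qed.

(** Rectangles replace the coordinate preimages as generators because they form a pi-system and are
    the sets on which [isotropic_gaussian] prescribes the law. *)
Lemma measurable_rectangleE :
  @measurable _ 'rV[R]_n = <<s measurable_rectangle >>.
Proof.
apply/seteqP; split; apply: smallest_sub.
- exact: smallest_sigma_algebra.
- rewrite -bigcup_seq => A [i _ [B mB <-]]; rewrite setTI.
  apply: sub_sigma_algebra; exists (fun j => if j == i then B else setT).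
    by move=> j /=; case: ifP.
  apply/seteqP; split=> x /=; first by move/(_ i); rewrite eqxx.
  by move=> Bx j; case: eqP => [->|].
- exact: sigma_algebra_measurable.
- move=> _ [B mB <-].
  rewrite (_ : rectangle B = \bigcap_(i in [set: 'I_n]) ((fun x : 'rV[R]_n => x ord0 i) @^-1` B i)); last first.
    by apply/seteqP; split=> x /= h i => [_|]; exact: h.
  apply: fin_bigcap_measurable => // i _; rewrite -[X in measurable X]setTI.
  exact: measurable_coord.
Qed.

Lemma measurable_rectangleI : setI_closed measurable_rectangle.
Proof.
move=> _ _ [B mB <-] [C mC <-]; exists (fun i => B i `&` C i).
  by move=> i; exact: measurableI.
apply/seteqP; split=> x /=; first by move=> h; split=> i; case: (h i).
by move=> [h1 h2] i; split.
Qed.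

Lemma measurable_rowP {d} {T : measurableType d} (f : T -> 'rV[R]_n) :
  (forall i, measurable_fun [set: T] (fun t => f t ord0 i)) ->
  measurable_fun [set: T] f.
Proof.
move=> mf; apply: (measurability measurable_rectangle measurable_rectangleE).
move=> _ [_ [B mB <-] <-]; rewrite setTI.
rewrite (_ : _ @^-1` _ = \bigcap_(i in [set: 'I_n]) ((fun t => f t ord0 i) @^-1` B i)); last first.
  by apply/seteqP; split=> x /= h i => [_|]; exact: h.
apply: fin_bigcap_measurable => // i _; rewrite -[X in measurable X]setTI.
exact: mf.
Qed.

Lemma measurable_row_shift (a : 'rV[R]_n) :
  measurable_fun [set: 'rV[R]_n] (fun x : 'rV[R]_n => x + a).
Proof.
apply: measurable_rowP => i; under eq_fun do rewrite mxE.
by apply: measurable_funD => //; exact: measurable_coord.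
Qed.

End rectangles.

Section normal_tilt.
Local Open Scope ring_scope.
Context {R : realType}.
Local Notation mu := (@lebesgue_measure R).

Lemma lebesgue_measure_shift (a : R) (A : set R) : measurable A ->
  pushforward mu ((fun x => x + a) : _ -> measurableTypeR R) A = mu A.
Proof.
have msh : measurable_fun [set: measurableTypeR R]
    ((fun x => x + a) : _ -> measurableTypeR R) by exact: measurable_funD.
move=> mA; apply/esym/lebesgue_measure_unique => //= _ [[b c]] _ <-.
rewrite /pushforward (_ : _ @^-1` _ = `]b - a, c - a]%classic); last first.
  by apply/seteqP; split=> x /=; rewrite !in_itv/= ltrBlDr lerBrDr.
by rewrite !lebesgue_measure_itv/= !lte_fin ltrD2r -!EFinD opprD addrACA subrr addr0.
Qed.

Lemma ge0_integral_shift (a : R) (h : R -> \bar R) :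
  measurable_fun [set: R] h -> (forall x, 0 <= h x)%E ->
  (\int[mu]_x h (x + a)%R = \int[mu]_x h x)%E.
Proof.
move=> mh h0.
transitivity (\int[pushforward mu ((fun x => (x + a)%R) : _ -> measurableTypeR R)]_x h x)%E.
  rewrite (@ge0_integral_pushforward _ _ _ _ _ _ _ _ setT)//.
  exact: measurable_funD.
by apply: eq_measure_integral => [|? A mA _]; [exact: measurable_funD|exact: lebesgue_measure_shift].
Qed.

(* Density of N(a, s^2) with respect to N(0, s^2). *)
Definition tilt (s a x : R) : R := expR (a * x / s ^+ 2 - a ^+ 2 / (s ^+ 2 *+ 2)).

Lemma measurable_tilt s a : measurable_fun [set: R] (tilt s a).
Proof.
apply: measurableT_comp => //; apply: measurable_funB => //.
by apply: measurable_funM => //; exact: measurable_funM.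
Qed.

Lemma normal_pdf_shift s a x : s != 0 ->
  normal_pdf 0 s (x - a) = normal_pdf 0 s x * tilt s a x.
Proof.
move=> s0; rewrite !normal_pdfE// -mulrA -expRD; congr (_ * expR _).
by field.
Qed.

(** The substitution [y = x + a] moves the shift from the set to the density, where
    [normal_pdf_shift] turns it into a [tilt] factor. *)
Lemma normal_prob_shift s a (B : set R) : s != 0 -> measurable B ->
  normal_prob 0 s [set x | B (x + a)] =
  (\int[mu]_x ((\1_B x)%:E * (tilt s a x)%:E * (normal_pdf 0 s x)%:E))%E.
Proof.
move=> s0 mB; rewrite /normal_prob integral_mkcond.
pose h y := ((\1_B y)%:E * (normal_pdf 0 s (y - a))%:E)%E.
transitivity (\int[mu]_x h (x + a)%R)%E.
  apply: eq_integral => x _; rewrite /h addrK /patch indicE.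
  by rewrite -[x \in _]/(x + a \in B); case: ifP; rewrite ?mul1e ?mul0e.
rewrite ge0_integral_shift.
- by apply: eq_integral => x _; rewrite /h normal_pdf_shift// EFinM (muleC (normal_pdf _ _ _)%:E) muleA.
- apply: emeasurable_funM; apply/measurable_EFinP; first exact: measurable_indic.
  apply: measurableT_comp; first exact: measurable_normal_pdf.
  exact: measurable_funB.
- by move=> x; rewrite mule_ge0// lee_fin// normal_pdf_ge0.
Qed.

End normal_tilt.

Section gaussian_shift.
Local Open Scope ring_scope.
Local Open Scope ereal_scope.
Context {R : realType} {n : nat} {d : measure_display} {Omega : measurableType d}
  {P : probability Omega R} {s : R} {Z : Omega -> 'rV[R]_n}.
Hypotheses (s0 : s != 0%R) (gZ : isotropic_gaussian P s Z).

Let mZ : measurable_fun [set: Omega] Z. Proof. by case: gZ. Qed.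

Let mZi i : measurable_fun [set: Omega] (fun w => Z w ord0 i).
Proof. exact: (measurableT_comp (measurable_coord i) mZ). Qed.

Let P_indic A : measurable A -> P A = \int[P]_w (\1_A w)%:E.
Proof. by move=> mA; rewrite integral_indic// setIT. Qed.

Let int1 : \int[P]_w cst 1%E w = 1.
Proof. by rewrite integral_cst// mul1e; exact: probability_setT. Qed.

Let others (k : 'I_n) (B : 'I_n -> set R) : set Omega :=
  [set w | forall i, i != k -> B i (Z w ord0 i)].

Let with_coord (k : 'I_n) (B : 'I_n -> set R) (A : set R) : 'I_n -> set R :=
  fun i => if i == k then A else B i.

Let others_coord k B A :
  others k B `&` [set w | A (Z w ord0 k)] = Z @^-1` rectangle (with_coord k B A).
Proof.
apply/seteqP; split=> w /=.
  by move=> [oB Ak] i; rewrite /with_coord; case: eqVneq => [->//|/oB].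
rewrite /rectangle/= => h; split; last by have := h k; rewrite /with_coord eqxx.
by move=> i ik; have := h i; rewrite /with_coord (negbTE ik).
Qed.

Let mwith_coord k B A : (forall i, measurable (B i)) -> measurable A ->
  forall i, measurable (with_coord k B A i).
Proof. by move=> mB mA i; rewrite /with_coord; case: ifP. Qed.

Let mothers k B : (forall i, measurable (B i)) -> measurable (others k B).
Proof.
move=> mB; rewrite -[others k B]setIT.
rewrite (_ : setT = [set w | [set: R] (Z w ord0 k)])// others_coord.
rewrite -[X in measurable X]setTI; apply: mZ => //.
rewrite measurable_rectangleE; apply: sub_sigma_algebra.
by exists (with_coord k B setT) => //; exact: mwith_coord.
Qed.

(** Independence of coordinate [k] from the remaining ones, read off the product formula on
    rectangles. *)
Let P_others k B A : (forall i, measurable (B i)) -> measurable A ->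
  P (others k B `&` [set w | A (Z w ord0 k)]) = P (others k B) * normal_prob 0%R s A.
Proof.
move=> mB mA.
have rect A' : measurable A' -> P (others k B `&` [set w | A' (Z w ord0 k)]) =
    (\prod_(i < n | i != k) normal_prob 0%R s (B i)) * normal_prob 0%R s A'.
  move=> mA'; rewrite others_coord; have [_ ->] := gZ; last exact: mwith_coord.
  rewrite (bigD1 k)//= muleC /with_coord eqxx; congr (_ * _).
  by apply: eq_bigr => i /negbTE ->.
rewrite rect//; congr (_ * _).
(* Leaving coordinate [k] free identifies the product over [i != k] with the probability of
   [others k B]. *)
have := rect setT measurableT; rewrite probability_setT mule1 => <-.
by congr (P _); apply/seteqP; split=> w //= [].
Qed.

(** Extends [P_others] from indicators to nonnegative functions. Both sides integrate [f] against a
    weighted law: on [Omega] the weight is the indicator of [others k B], on the line it is the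
    normal density times the constant [P (others k B)]. *)
Let integral_others k B (f : R -> \bar R) : (forall i, measurable (B i)) ->
  measurable_fun [set: R] f -> (forall x, 0 <= f x) ->
  \int[P]_w (f (Z w ord0 k) * (\1_(others k B) w)%:E) =
  P (others k B) * \int[lebesgue_measure]_x (f x * (normal_pdf 0 s x)%:E).
Proof.
move=> mB mf f0; have mo := @mothers k B mB.
have fo : P (others k B) \is a fin_num by exact: fin_num_measure.
have po : (0 <= fine (P (others k B)))%R by exact: fine_ge0.
have mpdf := measurable_normal_pdf (0 : R) s.
have p0 x := normal_pdf_ge0 (0 : R) s x.
transitivity (\int[lebesgue_measure]_x (f x * (fine (P (others k B)) * normal_pdf 0 s x)%:E)).
  apply: (@eq_weighted_law_integral _ _ _ _ _ _ _ P (@lebesgue_measure R)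
    (fun w => Z w ord0 k) id) => //.
  - exact: measurable_funM.
  - by move=> x; rewrite mulr_ge0.
  move=> A mA; transitivity (P (others k B `&` [set w | A (Z w ord0 k)])).
    rewrite P_indic.
      apply: eq_integral => w _; rewrite -EFinM; congr EFin.
      by rewrite indicI mulrC.
    apply: measurableI => //; rewrite -[X in measurable X]setTI.
    exact: mZi.
  rewrite P_others// /weighted_law /normal_prob [in LHS]integral_mkcond/=.
  rewrite -[in LHS](fineK fo) -ge0_integralZl//.
  - apply: eq_integral => x _; rewrite /patch indicE EFinM.
    by case: ifP => _; rewrite ?mul1e ?mul0e ?mule0.
  - apply/(measurable_restrictT _ _).1 => //.
    by apply/measurable_EFinP; exact: measurable_funTS.
  - by move=> x _; rewrite /patch; case: ifP => // _; rewrite lee_fin.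
rewrite -[in RHS](fineK fo) -ge0_integralZl//.
- by apply: eq_integral => x _; rewrite EFinM muleCA.
- by apply: emeasurable_funM => //; exact/measurable_EFinP.
- by move=> x _; rewrite mule_ge0// lee_fin.
Qed.

(** On a rectangle a shift along coordinate [k] moves the side [B k] alone, so independence reduces
    the claim to [normal_prob_shift]. Uniqueness of weighted laws then passes from rectangles to all
    Borel sets, and from there to functions. *)
Lemma gaussian_coord_shift (k : 'I_n) (a : R) (f : 'rV[R]_n -> \bar R) :
  measurable_fun [set: 'rV[R]_n] f -> (forall x, 0 <= f x) ->
  \int[P]_w f (Z w + a *: delta_mx ord0 k)%R =
  \int[P]_w (f (Z w) * (tilt s a (Z w ord0 k))%:E).
Proof.
move=> mf f0.
have mt : measurable_fun [set: Omega] (fun w => tilt s a (Z w ord0 k)).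
  exact: (measurableT_comp (measurable_tilt s a)).
have mZa : measurable_fun [set: Omega] (fun w => (Z w + a *: delta_mx ord0 k)%R).
  exact: (measurableT_comp (measurable_row_shift _) mZ).
transitivity (\int[P]_w (f (Z w + a *: delta_mx ord0 k)%R * 1%:E)).
  by apply: eq_integral => w _; rewrite mule1.
have lawE B : (forall i, measurable (B i)) ->
   weighted_law P (fun w => (Z w + a *: delta_mx ord0 k)%R) (cst 1%R) (rectangle B) =
   weighted_law P Z (fun w => tilt s a (Z w ord0 k)) (rectangle B).
  move=> mB.
  have mBa : measurable [set x | B k (x + a)%R].
    rewrite -[X in measurable X]setTI.
    by apply: (measurable_funD (@measurable_id _ _ _) (@measurable_cst _ _ _ _ _ a)).
  have mBaZ : measurable [set w | [set x | B k (x + a)%R] (Z w ord0 k)].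
    by rewrite -[X in measurable X]setTI; exact: mZi.
  transitivity (P (others k B `&` [set w | [set x | B k (x + a)%R] (Z w ord0 k)])).
    rewrite P_indic.
      apply: eq_integral => w _; rewrite -EFinM mulr1 !indicE; congr (_%:R%:E).
      congr nat_of_bool; apply/idP/idP; rewrite !inE /rectangle/=.
        move=> BZ; split=> [i ik|]; [have := BZ i|have := BZ k]; rewrite !mxE eqxx.
          by rewrite (negbTE ik) mulr0 addr0.
        by rewrite eqxx mulr1.
      move=> [oB Bk] i; rewrite !mxE eqxx/=; case: eqVneq => [->|ik].
        by rewrite mulr1.
      by rewrite mulr0 addr0; exact: oB.
    by apply: measurableI => //; exact: mothers.
  rewrite P_others// normal_prob_shift//.
  have := @integral_others k B (fun x => (\1_(B k) x)%:E * (tilt s a x)%:E) mB.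
  move=> <-.
  - apply: eq_integral => w _; rewrite muleAC; congr (_ * _).
    rewrite -EFinM; congr EFin; rewrite !indicE -natrM mulnb; congr (_%:R).
    congr nat_of_bool; apply/andP/idP; rewrite !inE /rectangle/=.
      by move=> [Bk oB] i; case: (eqVneq i k) => [->//|]; exact: oB.
    by move=> BZ; split=> [|i _]; exact: BZ.
  - apply: emeasurable_funM; apply/measurable_EFinP; first exact: measurable_indic.
    exact: measurable_tilt.
  - by move=> x; rewrite mule_ge0// lee_fin// expR_ge0.
apply: (@eq_weighted_law_integral _ _ _ _ _ _ _ P P
   (fun w => (Z w + a *: delta_mx ord0 k)%R) Z (cst 1%R)) => //.
  by move=> w; exact: expR_ge0.
apply: (@weighted_law_unique _ _ _ _ _ _ _ P P _ _ _ _ _ _ _ _ _ _ measurable_rectangle) => //.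
- by move=> w; exact: expR_ge0.
- exact: measurable_rectangleE.
- exact: measurable_rectangleI.
- have -> : [set: 'rV[R]_n] = rectangle (fun=> setT) by apply/seteqP; split.
  exact: lawE.
- apply: (@le_lt_trans _ _ (\int[P]_w cst 1%E w)); last first.
    by rewrite int1 ltry.
  by rewrite le_eqVlt; apply/orP; left; apply/eqP/eq_integral => w _; rewrite indicT mul1e.
- by move=> _ [B mB <-]; exact: lawE.
Qed.

(** The density of [N(mu, s^2 I)] with respect to [N(0, s^2 I)], for nonzero [s]. *)
Definition likelihood (s : R) (mu z : 'rV[R]_n) : R :=
  (\prod_(i < n) tilt s (mu ord0 i) (z ord0 i))%R.

Lemma likelihood_ge0 t mu z : (0 <= likelihood t mu z)%R.
Proof. by apply: prodr_ge0 => i _; exact: expR_ge0. Qed.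

Lemma measurable_likelihood t mu : measurable_fun [set: 'rV[R]_n] (likelihood t mu).
Proof.
apply: measurable_prod => i _.
exact: (measurableT_comp (measurable_tilt _ _) (measurable_coord i)).
Qed.

(** The Cameron-Martin formula in finite dimension, obtained by shifting one coordinate after
    another along a duplicate-free list. *)
Lemma gaussian_shift (mu : 'rV[R]_n) (f : 'rV[R]_n -> \bar R) :
  measurable_fun [set: 'rV[R]_n] f -> (forall x, 0 <= f x) ->
  \int[P]_w f (Z w + mu)%R = \int[P]_w (f (Z w) * (likelihood s mu (Z w))%:E).
Proof.
suff shift_seq (r : seq 'I_n) : uniq r -> forall g : 'rV[R]_n -> \bar R,
    measurable_fun [set: 'rV[R]_n] g -> (forall x, 0 <= g x) ->
    \int[P]_w g (Z w + \sum_(i <- r) mu ord0 i *: delta_mx ord0 i)%R =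
    \int[P]_w (g (Z w) * (\prod_(i <- r) tilt s (mu ord0 i) (Z w ord0 i))%R%:E).
  move=> mf f0; rewrite [in LHS](row_sum_delta mu).
  by rewrite shift_seq// index_enum_uniq.
elim: r => [_|k r ih /= /andP[kr ur]] g mg g0.
  by apply: eq_integral => w _; rewrite !big_nil addr0 mule1.
pose v : 'rV[R]_n := (\sum_(i <- r) mu ord0 i *: delta_mx ord0 i)%R.
have vk : v ord0 k = 0%R.
  rewrite /v summxE big_seq big1// => i ir; rewrite !mxE eqxx/=.
  by case: eqP ir => [<-|_ _]; rewrite ?(negbTE kr)// mulr0.
transitivity (\int[P]_w g ((Z w + mu ord0 k *: delta_mx ord0 k) + v)%R).
  by apply: eq_integral => w _; rewrite big_cons addrA.
rewrite (@gaussian_coord_shift k (mu ord0 k) (fun z => g (z + v)%R))//; last first.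
  exact: (measurableT_comp mg (measurable_row_shift v)).
(* The factor of coordinate [k] is absorbed into the test function: [v] vanishes at [k], so
   translating by [v] leaves this factor unchanged. *)
pose h z := g z * (tilt s (mu ord0 k) (z ord0 k))%:E.
transitivity (\int[P]_w h (Z w + v)%R).
  by apply: eq_integral => w _; rewrite /h mxE vk addr0.
rewrite ih//.
- by apply: eq_integral => w _; rewrite /h big_cons EFinM muleA.
- apply: emeasurable_funM => //; apply/measurable_EFinP.
  exact: (measurableT_comp (measurable_tilt _ _) (measurable_coord k)).
- by move=> x; rewrite mule_ge0// lee_fin expR_ge0.
Qed.

(** Yields the second moment of the likelihood ratio without a further Gaussian integral:
    [gaussian_shift] gives [E[L(Z)^2] = E[L(Z + mu)]], which is [E[L(Z)] = 1] times the exponential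
    factor. *)
Lemma likelihood_shift t (mu z : 'rV[R]_n) : t != 0%R ->
  likelihood t mu (z + mu)%R = (likelihood t mu z * expR (l2norm mu ^+ 2 / t ^+ 2))%R.
Proof.
move=> t0; rewrite /l2norm sqr_sqrtr; last by apply: sumr_ge0 => i _; exact: sqr_ge0.
rewrite mulr_suml expR_sum -big_split/=; apply: eq_bigr => i _.
by rewrite /tilt -expRD mxE; congr expR; field.
Qed.

Lemma gaussian_shift_prob (mu : 'rV[R]_n) (l : R) (A : set 'rV[R]_n) :
  measurable A -> (0 < l)%R ->
  P [set w | A (Z w + mu)%R] <=
  (l / 2)%:E * P [set w | A (Z w)] + (expR (l2norm mu ^+ 2 / s ^+ 2) / (2 * l))%:E.
Proof.
move=> mA l0.
have mL := measurable_likelihood s mu.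
have mLZ : measurable_fun [set: Omega] (likelihood s mu \o Z) by exact: measurableT_comp.
have mAZ v : measurable [set w | A (Z w + v)%R].
  rewrite -[X in measurable X]setTI.
  exact: (measurableT_comp (measurable_row_shift v) mZ).
have mAZ0 : measurable [set w | A (Z w)].
  by rewrite -[X in measurable X]setTI; exact: mZ.
have mI : measurable_fun [set: 'rV[R]_n] (fun x => (\1_A x)%:E : \bar R).
  by apply/measurable_EFinP; exact: measurable_indic.
have L0 z : 0 <= (likelihood s mu z)%:E by rewrite lee_fin likelihood_ge0.
(* This is the shift formula for the constant function [1]. *)
have IL : \int[P]_w (likelihood s mu (Z w))%:E = 1.
  rewrite -int1 -[RHS]/(\int[P]_w (cst 1%E (Z w + mu)%R)).
  rewrite (gaussian_shift mu (f := cst 1%E))//.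
  by apply: eq_integral => w _; rewrite mul1e.
have IL2 : \int[P]_w ((likelihood s mu (Z w))%:E * (likelihood s mu (Z w))%:E) =
    (expR (l2norm mu ^+ 2 / s ^+ 2))%:E.
  rewrite -(gaussian_shift mu (f := EFin \o likelihood s mu))//; last exact/measurable_EFinP.
  under eq_integral do rewrite /= likelihood_shift// EFinM muleC.
  rewrite ge0_integralZl ?lee_fin ?expR_ge0//; last exact/measurable_EFinP.
  by rewrite IL mule1.
have l20 : (0 <= l / 2)%R by rewrite divr_ge0// ltW.
have l2V0 : (0 <= (2 * l)^-1)%R by rewrite invr_ge0 mulr_ge0// ltW.
have mIZ : measurable_fun [set: Omega] (fun w => (\1_A (Z w))%:E : \bar R).
  exact: (measurableT_comp mI mZ).
have mLL : measurable_fun [set: Omega]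
    (fun w => (likelihood s mu (Z w))%:E * (likelihood s mu (Z w))%:E).
  by apply: emeasurable_funM; exact/measurable_EFinP.
apply: (@le_trans _ _ (\int[P]_w ((l / 2)%:E * (\1_A (Z w))%:E +
  ((2 * l)^-1)%:E * ((likelihood s mu (Z w))%:E * (likelihood s mu (Z w))%:E)))); last first.
  rewrite ge0_integralD//; last 4 first.
  - by move=> w _; rewrite -EFinM lee_fin mulr_ge0.
  - exact: measurable_funeM.
  - by move=> w _; rewrite mule_ge0 ?mule_ge0// lee_fin.
  - exact: measurable_funeM.
  rewrite !ge0_integralZl//; last by move=> w _; rewrite mule_ge0.
  rewrite IL2 -EFinM (mulrC _^-1%R) leeD2r// lee_wpmul2l ?lee_fin//.
  by rewrite P_indic.
rewrite P_indic//.
apply: (@le_trans _ _ (\int[P]_w ((\1_A (Z w))%:E * (likelihood s mu (Z w))%:E))).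
  by rewrite -(gaussian_shift mu (f := fun x => (\1_A x)%:E)).
apply: ge0_le_integral => //.
- by move=> w ?; rewrite mule_ge0.
- by apply: emeasurable_funM => //; exact/measurable_EFinP.
- by apply: emeasurable_funD; exact: measurable_funeM.
move=> w _; rewrite -!EFinM -EFinD lee_fin.
(* On [A] the difference of the two sides is a multiple of a square; off [A] the left side is
   [0]. *)
set L := likelihood s mu (Z w); rewrite indicE; case: (_ \in _) => /=.
  rewrite mul1r mulr1 -subr_ge0.
  have -> : (l / 2 + (2 * l)^-1 * (L * L) - L = (2 * l)^-1 * (l - L) ^+ 2)%R.
    by field; rewrite gt_eqF.
  by rewrite mulr_ge0// sqr_ge0.
by rewrite mul0r mulr0 add0r -expr2 mulr_ge0// sqr_ge0.
Qed.

End gaussian_shift.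

(** * Risk lower bound from a separated family *)

Section l2norm_theory.
Local Open Scope ring_scope.
Context {R : realType} {p : nat}.
Implicit Types x y : 'rV[R]_p.

Lemma l2norm_ge0 x : 0 <= l2norm x. Proof. exact: sqrtr_ge0. Qed.

Lemma sqr_l2norm x : l2norm x ^+ 2 = \sum_(i < p) x ord0 i ^+ 2.
Proof. by rewrite sqr_sqrtr// sumr_ge0// => i _; exact: sqr_ge0. Qed.

Lemma l2norm0 : l2norm (0 : 'rV[R]_p) = 0.
Proof. by rewrite /l2norm big1 ?sqrtr0// => i _; rewrite mxE expr0n. Qed.

Lemma l2normN x : l2norm (- x) = l2norm x.
Proof. by rewrite /l2norm; under eq_bigr do rewrite mxE sqrrN. Qed.

Lemma l2normB x y : l2norm (x - y) = l2norm (y - x).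
Proof. by rewrite -l2normN opprB. Qed.

Lemma l2normZ (a : R) x : l2norm (a *: x) = `|a| * l2norm x.
Proof.
rewrite /l2norm; under eq_bigr do rewrite mxE exprMn.
by rewrite -mulr_sumr sqrtrM ?sqr_ge0// sqrtr_sqr.
Qed.

(* Used instead of the triangle inequality, so that Cauchy-Schwarz is not needed. *)
Lemma sqr_l2normD_le x y :
  l2norm (x + y) ^+ 2 <= 2 * (l2norm x ^+ 2 + l2norm y ^+ 2).
Proof.
rewrite !sqr_l2norm -big_split/= mulr_sumr; apply: ler_sum => i _.
rewrite mxE -subr_ge0.
by rewrite (_ : _ - _ = (x ord0 i - y ord0 i) ^+ 2) ?sqr_ge0//; ring.
Qed.

Lemma measurable_sqr_l2norm d (T : measurableType d) (f : T -> 'rV[R]_p) :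
  measurable_fun [set: T] f -> measurable_fun [set: T] (fun t => l2norm (f t) ^+ 2).
Proof.
move=> mf; under eq_fun do rewrite sqr_l2norm.
apply: measurable_sum => i; apply: measurable_funX.
exact: (measurableT_comp (measurable_coord i) mf).
Qed.

End l2norm_theory.

Section testing.
Local Open Scope ring_scope.
Local Open Scope ereal_scope.
Context {R : realType} {p n : nat} {d : measure_display} {Omega : measurableType d}
  {P : probability Omega R} {s : R} {Z : Omega -> 'rV[R]_n}.
Hypotheses (s0 : s != 0%R) (gZ : isotropic_gaussian P s Z).

Let mZ : measurable_fun [set: Omega] Z. Proof. by case: gZ. Qed.

(* The bound is [m ^ (-1/4)]; the proof takes [l = m ^ (3/4)] in
   [gaussian_shift_prob]. *)
Lemma gaussian_tests (m : nat) (mu : 'I_m -> 'rV[R]_n) (A : 'I_m -> set 'rV[R]_n) :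
  (0 < m)%N -> (forall i, measurable (A i)) -> trivIset [set: 'I_m] A ->
  (forall i, (l2norm (mu i) ^+ 2 / s ^+ 2 <= ln m%:R / 2)%R) ->
  exists i, P [set w | A i (Z w + mu i)%R] <= (expR (- (ln m%:R / 4)))%:E.
Proof.
move=> m0 mA tA mu_le; apply/not_existsP => gt_q.
(* With [u = m^(1/4)] every quantity is a power of [u]: the number of tests is [u^4], the second
   moments are at most [u^2], and [l = u^3]. *)
pose u : R := expR (ln m%:R / 4).
have u0 : (0 < u)%R by exact: expR_gt0.
have u4 : (u ^+ 4 = m%:R)%R.
  by rewrite -expRM_natr mulfVK// lnK// posrE ltr0n.
have u2 : (expR (ln m%:R / 2) = u ^+ 2)%R.
  by rewrite -expRM_natr; congr expR; field.
have l0 : (0 < u ^+ 3)%R by exact: exprn_gt0.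
have mAZ i : measurable [set w | A i (Z w)].
  by rewrite -[X in measurable X]setTI; exact: mZ.
have sum_le1 : \sum_(i < m) P [set w | A i (Z w)] <= 1.
  have <- := @measure_bigsetU_ord _ _ _ P m xpredT (fun i => [set w | A i (Z w)]).
  - by apply: probability_le1; exact: bigsetU_measurable.
  - exact: mAZ.
  - apply/trivIsetP => i j _ _ ij; move/trivIsetP: tA => /(_ i j I I ij) AA.
    by rewrite -subset0 => w /= h; have : (A i `&` A j) (Z w) by []; rewrite AA.
have fP B : measurable B -> P B \is a fin_num by move=> mB; exact: fin_num_measure.
have mAZmu i : measurable [set w | A i (Z w + mu i)%R].
  rewrite -[X in measurable X]setTI.
  exact: (measurableT_comp (measurable_row_shift (mu i)) mZ).
have sum_le1' : (\sum_(i < m) fine (P [set w | A i (Z w)]) <= 1)%R.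
  rewrite -lee_fin -sumEFin; apply: le_trans sum_le1.
  by apply: lee_sum => i _; rewrite fineK// fP.
have u5 : (expR (- (ln m%:R / 4)) = u^-1)%R by rewrite expRN.
have le_i (i : 'I_m) : (u^-1 < u ^+ 3 / 2 * fine (P [set w | A i (Z w)]) +
    u ^+ 2 / (2 * u ^+ 3))%R.
  rewrite ltNge; apply/negP => h; apply: (gt_q i); rewrite u5.
  apply: (le_trans (gaussian_shift_prob s0 gZ (mu i) (mA i) l0)).
  rewrite -(fineK (fP _ (mAZ i))) -EFinM -EFinD lee_fin.
  apply: le_trans h; rewrite lerD2l ler_wpM2r//.
    by rewrite invr_ge0 mulr_ge0// ltW.
  by rewrite -u2 ler_expR.
have : (\sum_(i < m) u^-1 < \sum_(i < m) (u ^+ 3 / 2 * fine (P [set w | A i (Z w)]) +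
    u ^+ 2 / (2 * u ^+ 3)))%R.
  apply: ltr_sum => [|i _]; last exact: le_i.
  by apply/hasP; exists (Ordinal m0) => //; rewrite mem_index_enum.
rewrite big_split/= -mulr_sumr !sumr_const card_ord.
rewrite -(mulr_natr (u^-1)) -(mulr_natr (u ^+ 2 / (2 * u ^+ 3))) -u4.
apply/negP; rewrite -leNgt.
(* The right-hand sum is at most [u^3 / 2 + u^3 / 2 = u^3], while the left-hand sum is
   [m u^-1 = u^3]; this contradicts the strict inequality. *)
apply: (@le_trans _ _ (u ^+ 3 / 2 * 1 + u ^+ 2 / (2 * u ^+ 3) * u ^+ 4)%R).
  by rewrite lerD2r ler_wpM2l// divr_ge0// ltW.
by rewrite le_eqVlt; apply/orP; left; apply/eqP; field; rewrite gt_eqF.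
Qed.

End testing.

(* [2 ^ (-1/4)] bounds [m ^ (-1/4)] for [m >= 2]. *)
Definition packing_const (R : realType) : R := ((1 - expR (- (ln 2 / 4))) / 8)%R.

Lemma packing_const_gt0 (R : realType) : (0 < packing_const R)%R.
Proof.
rewrite /packing_const divr_gt0// subr_gt0 expR_lt1 oppr_lt0 divr_gt0// ln_gt0//.
by rewrite ltr1n.
Qed.

Section packing_lower_bound.
Local Open Scope ring_scope.
Local Open Scope ereal_scope.
Context {R : realType} {p n : nat} {d : measure_display} {Omega : measurableType d}
  {P : probability Omega R} {s : R} {Z : Omega -> 'rV[R]_n}.
Hypotheses (s0 : s != 0%R) (gZ : isotropic_gaussian P s Z).
Variables (X : {linear 'rV[R]_p -> 'rV[R]_n}) (T : set 'rV[R]_p).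

Let mZ : measurable_fun [set: Omega] Z. Proof. by case: gZ. Qed.

(** Markov's inequality: the squared error is at least [r ^+ 2] off the event, whose complement has
    probability at least [1 - q]. *)
Lemma expectation_sqr_error (Mhat : 'rV[R]_n -> 'rV[R]_p) (y : 'rV[R]_n)
    (theta : 'rV[R]_p) (r q : R) :
  measurable_fun [set: 'rV[R]_n] Mhat ->
  P [set w | (l2norm (Mhat (Z w + y)%R - theta) ^+ 2 < r ^+ 2)%R] <= q%:E ->
  (r ^+ 2 * (1 - q))%:E <= 'E_P[fun w => (l2norm (Mhat (y + Z w) - theta) ^+ 2)%R].
Proof.
move=> mM; set A := [set w | _] => PA.
have merr : measurable_fun [set: Omega]
    (fun w => l2norm (Mhat (Z w + y)%R - theta) ^+ 2)%R.
  apply: measurable_sqr_l2norm.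
  apply: (measurableT_comp (measurable_row_shift (- theta)%R)).
  apply: (measurableT_comp mM).
  exact: (measurableT_comp (measurable_row_shift y) mZ).
have mA : measurable A.
  rewrite -[A]setTI (_ : A = (fun w => l2norm (Mhat (Z w + y)%R - theta) ^+ 2)%R @^-1` `]-oo, (r ^+ 2)%R[%classic).
    by apply: merr => //; exact: measurable_itv.
  by apply/seteqP; split=> w /=; rewrite in_itv.
rewrite unlock.
apply: (@le_trans _ _ (\int[P]_w ((r ^+ 2)%:E * (\1_(~` A) w)%:E))).
  rewrite ge0_integralZl//; last 2 first.
  - by apply/measurable_EFinP; apply: measurable_indic; exact: measurableC.
  - by rewrite lee_fin sqr_ge0.
  rewrite integral_indic//; last exact: measurableC.
  rewrite setIT EFinM lee_wpmul2l ?lee_fin ?sqr_ge0// EFinB.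
  apply: (@le_trans _ _ (1 - P A)); first by rewrite leeB.
  by rewrite -probability_setC.
apply: ge0_le_integral => //.
- by move=> w ?; rewrite mule_ge0// lee_fin sqr_ge0.
- apply: measurable_funeM; apply/measurable_EFinP; apply: measurable_indic.
  exact: measurableC.
- by under eq_fun do rewrite (addrC y); exact/measurable_EFinP.
move=> w ?; rewrite -EFinM lee_fin indicE in_setC.
case: (boolP (w \in A)) => /=; rewrite ?mulr0 ?sqr_ge0// mulr1 notin_setE /A/= => /negP.
by rewrite -leNgt (addrC y).
Qed.

Hypothesis T_cone : forall (t : R) x, (0 <= t)%R -> T x -> T (t *: x)%R.

Lemma minimax_risk_packing (psi eps : R) (m : nat) (x_ : 'I_m -> 'rV[R]_p) :
  (0 < psi)%R -> (forall h, T h -> l2norm (X h) <= psi * l2norm h)%R ->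
  (0 < eps)%R -> (1 < m)%N ->
  (forall i, (@l2ball R p `&` T) (x_ i)) ->
  (forall i j, i != j -> eps <= l2norm (x_ i - x_ j))%R ->
  (packing_const R * (s ^+ 2 * eps ^+ 2 * ln m%:R / psi ^+ 2))%:E <=
  minimax_risk P X Z T.
Proof.
move=> psi0 Xpsi eps0 m1 xK sep.
apply: le_ereal_inf_tmp => _ [Mhat mM <-].
have lnm0 : (0 < ln m%:R :> R)%R by rewrite ln_gt0// ltr1n.
have s20 : (0 < s ^+ 2)%R by rewrite exprn_even_gt0.
(* The largest scale allowed by [gaussian_tests]: it makes [(psi * delta)^2 / s^2] equal to
   [ln m / 2]. *)
pose delta := Num.sqrt (s ^+ 2 * ln m%:R / (2 * psi ^+ 2))%R.
have delta2 : (delta ^+ 2 = s ^+ 2 * ln m%:R / (2 * psi ^+ 2))%R.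
  by rewrite sqr_sqrtr// divr_ge0// mulr_ge0 ?sqr_ge0 ?(ltW lnm0).
have delta0 : (0 < delta)%R.
  by rewrite sqrtr_gt0; apply: divr_gt0; apply: mulr_gt0 => //; exact: exprn_gt0.
pose theta i := (delta *: x_ i)%R.
(* Half the separation of the [theta i]. Since [2 (r^2 + r^2) = (delta eps)^2], [sqr_l2normD_le] is
   just sharp enough to make the events disjoint. *)
pose r := (delta * eps / 2)%R.
pose A i : set 'rV[R]_n := [set y | (l2norm (Mhat y - theta i) ^+ 2 < r ^+ 2)%R].
have mA i : measurable (A i).
  rewrite -[A i]setTI (_ : A i = (fun y => l2norm (Mhat y - theta i) ^+ 2)%R @^-1` `]-oo, (r ^+ 2)%R[%classic).
    apply: measurable_sqr_l2norm => //.
    exact: (measurableT_comp (measurable_row_shift (- theta i)%R) mM).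
  by apply/seteqP; split=> w /=; rewrite in_itv.
have tA : trivIset [set: 'I_m] A.
  apply/trivIsetP => i j _ _ ij; rewrite -subset0 => y [/= Ai Aj].
  have := sqr_l2normD_le (theta i - Mhat y) (Mhat y - theta j).
  rewrite addrA subrK l2normB -scalerBr l2normZ exprMn gtr0_norm// leNgt => /negP; apply.
  apply: (@lt_le_trans _ _ (2 * (r ^+ 2 + r ^+ 2))%R).
    by rewrite ltr_pM2l// ltrD// l2normB.
  rewrite (_ : 2 * _ = delta ^+ 2 * eps ^+ 2)%R; last by rewrite /r; field.
  rewrite ler_wpM2l ?sqr_ge0// lerXn2r ?nnegrE ?l2norm_ge0 ?(ltW eps0)//.
  by rewrite l2normB sep.
have mu_le i : (l2norm (X (theta i)) ^+ 2 / s ^+ 2 <= ln m%:R / 2)%R.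
  have [x1 Tx] := xK i.
  rewrite ler_pdivrMr//.
  apply: (@le_trans _ _ ((psi * delta) ^+ 2)%R); last first.
    by rewrite exprMn delta2 le_eqVlt; apply/orP; left; apply/eqP; field; rewrite gt_eqF.
  rewrite lerXn2r ?nnegrE ?l2norm_ge0// ?mulr_ge0 ?(ltW psi0) ?(ltW delta0)//.
  apply: (le_trans (Xpsi _ _)); first by apply: T_cone => //; exact: ltW.
  by rewrite ler_pM2l// l2normZ gtr0_norm// ler_piMr// ltW.
have [i Pi] := gaussian_tests s0 gZ (ltnW m1) mA tA mu_le.
apply: le_trans (ereal_sup_ubound _); last first.
  exists (theta i); last reflexivity.
  by apply: T_cone; [exact: ltW|case: (xK i)].
apply: le_trans (expectation_sqr_error mM Pi).
rewrite lee_fin /packing_const.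
(* The [8] in [packing_const] is the [4] from [r ^+ 2] times the [2] from [delta ^+ 2]. *)
rewrite (_ : _ * _ = r ^+ 2 * (1 - expR (- (ln 2 / 4))))%R.
  rewrite ler_wpM2l ?sqr_ge0// lerD2l lerN2 ler_expR lerN2 ler_wpM2r// ler_ln ?posrE ?ltr0n ?ler_nat//.
  exact: ltnW.
by rewrite /r !exprMn delta2; field; rewrite gt_eqF.
Qed.

End packing_lower_bound.

(** * Packing, covering and volume *)

Section packing_covering.
Local Open Scope ring_scope.
Local Open Scope ereal_scope.
Context {R : realType} {p : nat}.
Implicit Types (K : set 'rV[R]_p) (eps : R).

Definition separated_family K eps (m : nat) (x_ : 'I_m -> 'rV[R]_p) : Prop :=
  (forall i, K (x_ i)) /\ forall i j, i != j -> (eps <= l2norm (x_ i - x_ j))%R.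

Lemma counting_range_le (m : nat) (x_ : 'I_m -> 'rV[R]_p) :
  counting (range x_) <= m%:R%:E :> \bar R.
Proof.
have fin : finite_set (range x_) by exact: finite_image.
rewrite /counting asboolT// lee_fin ler_nat; apply: geq_card_fset_set.
pose x' k := if insub k is Some i then x_ i else 0%R.
apply: (@card_le_trans _ _ _ (x' @` `I_m)); last exact: card_image_le.
apply: subset_card_le => _ [i _ <-]; exists (nat_of_ord i) => //=.
by rewrite /x' valK.
Qed.

(** Either packings of every size exist, or some size [m] is attained while [m.+1] is not; a packing
    of that size is a net, since a point far from it could be added. *)
Lemma packing_or_covering K eps : (0 < eps)%R ->
  (forall m, exists x_, @separated_family K eps m x_) \/
  exists m, (exists x_, @separated_family K eps m x_) /\
    covering_number K eps <= m%:R%:E.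
Proof.
move=> eps0; case: (pselect (forall m, exists x_, @separated_family K eps m x_)).
  by left.
move=> /existsNP[m0 Nm0]; right.
have [m [[x_ [xK xsep]] Nm]] : exists m, (exists x_, @separated_family K eps m x_) /\
    ~ exists x_, @separated_family K eps m.+1 x_.
  (* Descends from a size that fails; the empty family shows that size [0] never fails. *)
  elim: m0 Nm0 => [[]|m ih Nm].
    have f0 : 'I_0 -> 'rV[R]_p by case.
    by exists f0; split=> -[].
  have [sm|Nsm] := pselect (exists x_, @separated_family K eps m x_); last exact: ih.
  by exists m.
exists m; split; first by exists x_.
apply: ge_ereal_inf; exists (counting (range x_)); last exact: counting_range_le.
exists (range x_) => //; split=> [_ [i _ <-]//|x Kx].
apply: contrapT => far; apply: Nm.
have {}far i : (eps <= l2norm (x - x_ i))%R.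
  by rewrite leNgt; apply/negP => xi; apply: far; exists (x_ i) => //; exists i.
(* The far point [x] is appended at the last index. *)
exists (fun i => if unlift ord_max i is Some j then x_ j else x).
split=> [i|i j]; first by case: unliftP.
case: unliftP => [i' ->|->]; case: unliftP => [j' ->|->].
- by rewrite (inj_eq lift_inj); exact: xsep.
- by move=> _; rewrite l2normB.
- by [].
- by rewrite eqxx.
Qed.

End packing_covering.

Section volume_covering.
Local Open Scope ring_scope.
Local Open Scope ereal_scope.
Context {R : realType} {p : nat}.
Implicit Types (K : set 'rV[R]_p) (eps : R).

Lemma box_volume_ge0 (b : 'rV[R]_p * 'rV[R]_p) : (0 <= box_volume b)%R.
Proof. by apply: prodr_ge0 => i _; rewrite le_max lexx. Qed.

Lemma box_volume_affine (b : 'rV[R]_p * 'rV[R]_p) (a : 'rV[R]_p) eps : (0 < eps)%R ->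
  box_volume (a + eps *: b.1, a + eps *: b.2)%R = (eps ^+ p * box_volume b)%R.
Proof.
move=> eps0; have -> : (eps ^+ p = \prod_(i < p) eps)%R by rewrite prodr_const card_ord.
rewrite /box_volume -big_split/=.
apply: eq_bigr => i _; rewrite !mxE maxr_pMr ?ltW// mulr0; congr (Num.max _ _).
by ring.
Qed.

Lemma volume_ge0 K : 0 <= volume K.
Proof.
apply: le_ereal_inf_tmp => _ [b _ <-].
by apply: nneseries_ge0 => k _ _; rewrite lee_fin box_volume_ge0.
Qed.

Lemma le_volume K L : K `<=` L -> volume K <= volume L.
Proof.
by move=> KL; apply: le_ereal_inf => _ [b Lb <-]; exists b => //; exact: subset_trans Lb.
Qed.

Lemma sum_nat_divn (f : nat -> R) (m N : nat) : (0 < m)%N ->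
  (\sum_(0 <= j < N * m) f (j %/ m)%N = m%:R * \sum_(0 <= q < N) f q)%R.
Proof.
move=> m0; elim: N => [|N ih]; first by rewrite mul0n !big_geq// mulr0.
rewrite mulSn addnC (@big_cat_nat _ _ _ (N * m)) ?leq_addr//= ih.
rewrite big_nat_recr//= mulrDr; congr (_ + _)%R.
rewrite -{1}[(N * m)%N]add0n big_addn addKn.
rewrite (eq_big_nat _ _ (F2 := fun=> f N)); last first.
  by move=> i /andP[_ im]; rewrite addnC divnMDl// divn_small// addn0.
by rewrite sumr_const_nat subn0 mulr_natl.
Qed.

(** Any box cover of the unit ball, scaled by [eps] and copied around each of the [m] centres, is a
    box cover of [K]; scaling multiplies each box volume by [eps ^+ p]. *)
Lemma volume_cover_le K eps (m : nat) (x_ : nat -> 'rV[R]_p) :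
  (0 < eps)%R -> (0 < m)%N ->
  (forall x, K x -> exists2 i, (i < m)%N & (l2norm (x - x_ i) <= eps)%R) ->
  volume K <= (m%:R * eps ^+ p)%:E * volume (@l2ball R p).
Proof.
move=> eps0 m0 Kx; have c0 : (0 < m%:R * eps ^+ p)%R by rewrite mulr_gt0 ?exprn_gt0// ltr0n.
(* The constant changes sides so that the infimum defining the volume of the ball can be replaced by
   a single cover [b]. *)
rewrite -lee_pdivrMl//; apply: le_ereal_inf_tmp => _ [b Bb <-].
rewrite lee_pdivrMl//.
(* Enumerates the boxes [x_ i + eps * b q], for [i < m], as [j = q * m + i]. *)
pose b' j := (x_ (j %% m)%N + eps *: (b (j %/ m)%N).1, x_ (j %% m)%N + eps *: (b (j %/ m)%N).2)%R.
apply: (@le_trans _ _ (\sum_(0 <= j <oo) (box_volume (b' j))%:E)).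
  apply: ereal_inf_lbound; exists b' => // x /Kx[i im xi].
  have /Bb[q _ qx] : l2ball (eps^-1 *: (x - x_ i))%R.
    by rewrite /l2ball/= l2normZ gtr0_norm ?invr_gt0// ler_pdivrMl// mulr1.
  exists (q * m + i)%N => // l; have := qx l; rewrite /b'/= modnMDl modn_small//.
  rewrite divnMDl// divn_small// addn0 !mxE.
  by rewrite ler_pdivlMl// ler_pdivrMl// lerBrDl lerBlDl.
apply: lime_le; first by apply: is_cvg_nneseries => k _ _; rewrite lee_fin box_volume_ge0.
(* The first [N * m] boxes of [b'] are exactly the [m] copies of the first [N] boxes of [b]. *)
apply: nearW => N; apply: (@le_trans _ _ (\sum_(0 <= j < N * m) (box_volume (b' j))%:E)).
  by apply: lee_sum_nneg_natr => [k _ _|]; rewrite ?lee_fin ?box_volume_ge0// leq_pmulr.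
rewrite sumEFin; under eq_bigr do rewrite box_volume_affine//.
rewrite -mulr_sumr (sum_nat_divn (fun q => box_volume (b q)))// mulrA (mulrC _ m%:R) EFinM.
rewrite lee_wpmul2l ?lee_fin ?(ltW c0)// -sumEFin.
by apply: nneseries_lim_ge => k _; rewrite lee_fin box_volume_ge0.
Qed.

End volume_covering.

Section volume_ratio_sudakov.
Local Open Scope ring_scope.
Local Open Scope ereal_scope.
Context {R : realType} {p : nat}.
Implicit Types (K : set 'rV[R]_p) (eps : R).

Lemma sudakov_estimate_ge0 K : 0 <= sudakov_estimate K.
Proof.
apply: le_ereal_sup_tmp; eexists; first by exists 1%R => //=; exact: ltr01.
by rewrite mule_ge0// ?lee_fin// sqrte_ge0.
Qed.

Lemma covering_number_ge K eps (b : R) : (0 < eps)%R -> K !=set0 ->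
  volume K = b%:E -> (0 < b)%R ->
  forall c : R, volume (@l2ball R p) = c%:E ->  (0 < c)%R ->
  (b / (eps ^+ p * c))%:E <= covering_number K eps.
Proof.
move=> eps0 [x0 Kx0] Kb b0 c Bc c0; apply: le_ereal_inf_tmp => _ [S [SK Snet] <-].
rewrite /counting; case: asboolP => [finS|_]; last by rewrite leey.
pose r : seq 'rV[R]_p := finmap.enum_fset (fset_set S); rewrite -[X in X%:R]/(size r).
have Kc x : K x -> exists2 i, (i < size r)%N & (l2norm (x - nth 0%R r i) <= eps)%R.
  move=> /Snet[y Sy xy]; have yr : y \in r.
    by have yS := in_fset_set finS y; rewrite mem_set// in yS.
  exists (index y r); first by rewrite index_mem.
  by rewrite nth_index// ltW.
have r0 : (0 < size r)%N by have [i /(leq_ltn_trans (leq0n i))] := Kc _ Kx0.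
have := volume_cover_le eps0 r0 Kc; rewrite Kb Bc -EFinM !lee_fin.
by rewrite ler_pdivrMr ?mulr_gt0 ?exprn_gt0// mulrA.
Qed.

(** With [rho] the [p]-th root of the volume quotient, radius [rho / 2] forces a covering number of
    at least [2 ^+ p]. Hence [(rho / 2) sqrt (p ln 2)] is at most the Sudakov estimate, which gives
    the constant. *)
Lemma volume_ratio_le_sudakov K : (0 < p)%N -> K !=set0 -> K `<=` @l2ball R p ->
  volume_ratio K <= (2 / Num.sqrt (ln 2))%:E * sudakov_estimate K.
Proof.
move=> p0 K0 KB; have pV0 : (p%:R^-1 != 0 :> R)%R by rewrite invr_eq0 pnatr_eq0 -lt0n.
have ln20 : (0 < ln 2 :> R)%R by rewrite ln_gt0// ltr1n.
have rhs0 : 0 <= (2 / Num.sqrt (ln 2))%:E * sudakov_estimate K.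
  by rewrite mule_ge0 ?sudakov_estimate_ge0// lee_fin divr_ge0// sqrtr_ge0.
(* Disposes of the degenerate cases: [K] of volume [0], and a ball of volume [+oo], whose inverse is
   [0]. Otherwise the ball has positive volume because it contains [K]. *)
have ratio0 : volume K / volume (@l2ball R p) = 0 -> volume_ratio K = 0.
  by rewrite /volume_ratio => ->; rewrite poweR_EFin powR0// mule0.
have := le_volume KB; have := volume_ge0 K; have := volume_ge0 (@l2ball R p).
case Bc : (volume (@l2ball R p)) => [c| |]//; last first.
  by rewrite ratio0// Bc invey mule0.
case Kb : (volume K) => [b| |]// c0 b0 bc.
have [b00|bN0] := eqVneq b 0%R; first by rewrite ratio0// Kb b00 mul0e.
have {b0 bN0}b0 : (0 < b)%R by rewrite lt_neqAle eq_sym bN0 -lee_fin.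
have {c0}c0 : (0 < c)%R by apply: lt_le_trans b0 _; rewrite -lee_fin.
pose rho := ((b / c) `^ p%:R^-1)%R.
have bc0 : (0 < b / c)%R by rewrite divr_gt0.
have rho0 : (0 < rho)%R by exact: powR_gt0.
have rhop : (rho ^+ p = b / c)%R.
  by rewrite -powR_mulrn ?powR_ge0// -powRrM mulVf ?powRr1 ?(ltW bc0)// pnatr_eq0 -lt0n.
have -> : volume_ratio K = (Num.sqrt p%:R * rho)%:E.
  by rewrite /volume_ratio Kb Bc inver gt_eqF// -EFinM poweR_EFin -EFinM.
pose eps := (rho / 2)%R; have eps0 : (0 < eps)%R by rewrite divr_gt0.
have Nge := covering_number_ge eps0 K0 Kb b0 Bc c0.
apply: (@le_trans _ _ ((2 / Num.sqrt (ln 2))%:E * (eps%:E * sqrte (lne (covering_number K eps))))); last first.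
  rewrite lee_wpmul2l// ?lee_fin ?divr_ge0 ?sqrtr_ge0//.
  by apply: ereal_sup_ubound; exists eps.
apply: (@le_trans _ _ ((2 / Num.sqrt (ln 2))%:E * (eps%:E * (Num.sqrt (p%:R * ln 2))%:E))).
  rewrite -!EFinM lee_fin sqrtrM// /eps.
  rewrite (_ : (2 / _ * _)%R = (Num.sqrt p%:R * rho)%R)//.
  by field; rewrite gt_eqF// sqrtr_gt0.
apply: lee_wpmul2l; first by rewrite lee_fin divr_ge0// sqrtr_ge0.
apply: lee_wpmul2l; first by rewrite lee_fin ltW.
have e2 : (b / (eps ^+ p * c) = 2 ^+ p)%R.
  rewrite /eps exprMn exprVn rhop; field.
  by rewrite !gt_eqF.
rewrite -[leLHS]/(sqrte (p%:R * ln 2)%:E) lee_sqrt.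
  apply: le_trans (_ : lne (2 ^+ p)%:E <= _).
    by rewrite lne_EFin ?exprn_gt0// lnXn// mulr_natl.
  rewrite lee_lne -?e2 ?in_itv/= ?leey ?andbT ?lee_fin//.
    by rewrite e2 exprn_ge0.
  by apply: le_trans Nge; rewrite e2 lee_fin exprn_ge0.
rewrite lne_ge0; apply: le_trans Nge; rewrite e2 lee_fin exprn_ege1//.
by rewrite ler1n.
Qed.

End volume_ratio_sudakov.

(** * The Sudakov estimate is controlled by the minimax risk *)

Section sudakov_minimax.
Local Open Scope ring_scope.
Local Open Scope ereal_scope.
Context {R : realType} {p n : nat} {d : measure_display} {Omega : measurableType d}
  {P : probability Omega R} {s : R} {Z : Omega -> 'rV[R]_n}.
Hypotheses (s0 : s != 0%R) (gZ : isotropic_gaussian P s Z).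
Variables (X : {linear 'rV[R]_p -> 'rV[R]_n}) (T : set 'rV[R]_p).
Hypothesis T_cone : forall (t : R) x, (0 <= t)%R -> T x -> T (t *: x)%R.

(** A point of [T] keeps the inner supremum from being [-oo]. *)
Lemma minimax_risk_ge0 : T !=set0 -> 0 <= minimax_risk P X Z T.
Proof.
move=> [x Tx]; apply: le_ereal_inf_tmp => _ [Mhat _ <-].
apply: le_ereal_sup_tmp; eexists; first by exists x; [exact: Tx|reflexivity].
by apply: expectation_ge0 => w; exact: sqr_ge0.
Qed.

(** The lower bound solved for the Sudakov estimate, so that the packing inequality is handled with
    real numbers and the estimate is shown finite along the way. *)
Lemma sudakov_estimate_le_minimax (psi r : R) :
  (0 < psi)%R -> (forall h, T h -> l2norm (X h) <= psi * l2norm h)%R ->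
  (0 <= r)%R -> minimax_risk P X Z T <= r%:E ->
  sudakov_estimate (@l2ball R p `&` T) <=
  (psi * Num.sqrt (r / (packing_const R * s ^+ 2)))%:E.
Proof.
move=> psi0 Xpsi r0 riskr; apply: ge_ereal_sup => _ [eps /= eps0 <-].
have c0 := packing_const_gt0 R.
have s20 : (0 < s ^+ 2)%R by rewrite exprn_even_gt0.
have psi20 : (0 < psi ^+ 2)%R by exact: exprn_gt0.
have eps20 : (0 < eps ^+ 2)%R by exact: exprn_gt0.
have cs0 : (0 < packing_const R * s ^+ 2)%R by exact: mulr_gt0.
pose c := (packing_const R * s ^+ 2)%R.
have ln_le m : (1 < m)%N -> (exists x_, @separated_family _ _ (@l2ball R p `&` T) eps m x_) ->
    (eps ^+ 2 * ln m%:R <= psi ^+ 2 * (r / c))%R.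
  move=> m1 [x_ [xK sep]].
  have := minimax_risk_packing s0 gZ T_cone psi0 Xpsi eps0 m1 xK sep.
  move=> /le_trans/(_ riskr); rewrite lee_fin => /(ler_wpM2l (ltW psi20)) h.
  rewrite [leRHS]mulrA ler_pdivlMr//; apply: le_trans h.
  by rewrite le_eqVlt /c; apply/orP; left; apply/eqP; field; rewrite gt_eqF.
have rhs0 : 0 <= (psi * Num.sqrt (r / c))%:E.
  by rewrite lee_fin mulr_ge0// ?sqrtr_ge0// ltW.
case: (packing_or_covering (@l2ball R p `&` T) eps0) => [sep|[m [sep Nm]]].
  (* Packings of every size contradict a finite risk: [m] is taken with [ln m > y], whereas [ln_le]
     bounds [ln m] by [y]. The two added units ensure [1 < m]. *)
  pose y := (psi ^+ 2 * (r / c) / eps ^+ 2)%R.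
  pose m := (Num.bound (expR y)).+2.
  have : (y < ln m%:R)%R.
    rewrite -ltr_expR lnK ?posrE ?ltr0n//.
    apply: lt_le_trans (archi_boundP (expR_ge0 y)) _.
    by rewrite ler_nat /m -addn2 leq_addr.
  rewrite ltNge => /negP[]; rewrite /y ler_pdivlMr// mulrC.
  exact: ln_le.
(* The packing bound requires two points. Otherwise the covering number is at most [1], its
   logarithm is nonpositive and [sqrte] returns [0]. *)
have [m1|m1] := leqP m 1.
  apply: le_trans rhs0; rewrite [X in _ * X](_ : _ = 0) ?mule0//.
  apply/eqP; rewrite eq_le sqrte_ge0 andbT -[leRHS]sqrte0 lee_sqrt//.
  rewrite lne_le0; apply: (le_trans Nm).
  by rewrite lee_fin -[1%R]/(1%:R)%R ler_nat.
have lnm0 : (0 < ln m%:R :> R)%R by rewrite ln_gt0// ltr1n.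
apply: (@le_trans _ _ (eps%:E * (Num.sqrt (ln m%:R))%:E)).
  apply: lee_wpmul2l; first by rewrite lee_fin ltW.
  rewrite -[leRHS]/(sqrte (ln m%:R)%:E) lee_sqrt ?lee_fin ?(ltW lnm0)//.
  rewrite -lne_EFin ?ltr0n ?(ltnW m1)//.
  have [N0|N0] := leP (covering_number (@l2ball R p `&` T) eps) 0.
    by rewrite le0_lneNy// leNye.
  by rewrite lee_lne// in_itv/= ?leey ?andbT ?(ltW N0)// lee_fin.
rewrite -EFinM lee_fin -ler_sqr ?nnegrE ?mulr_ge0 ?sqrtr_ge0 ?(ltW eps0) ?(ltW psi0)//.
rewrite !exprMn !sqr_sqrtr ?(ltW lnm0) ?divr_ge0 ?(ltW cs0)//.
exact: ln_le.
Qed.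

End sudakov_minimax.

(** * Tangent cones and the final minimax bound *)

Section tangent_cone_theory.
Local Open Scope ring_scope.
Context {R : realType} {p : nat} (A : set 'rV[R]_p) (M : 'rV[R]_p).

Lemma tangent_coneZ (t : R) x : 0 <= t -> tangent_cone A M x -> tangent_cone A M (t *: x).
Proof.
move=> t0 [u [u0 [h Sh ->]]]; exists (t * u); split; first exact: mulr_ge0.
by exists h => //; rewrite scalerA.
Qed.

Lemma tangent_cone0 : tangent_cone A M 0.
Proof.
exists 0; split => //; exists 0; last by rewrite scaler0.
by rewrite /= addr0.
Qed.

Lemma local_upper_isometryP (n : nat) (X : {linear 'rV[R]_p -> 'rV[R]_n}) (psi : R) :
  (local_upper_isometry A M X = psi%:E)%E ->
  forall h, tangent_cone A M h -> l2norm (X h) <= psi * l2norm h.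
Proof.
move=> psiE h Th; have [->|h0] := eqVneq h 0.
  by rewrite linear0 !l2norm0 mulr0.
have hn0 : 0 < l2norm h.
  rewrite lt_neqAle l2norm_ge0 andbT eq_sym; apply: contra h0 => /eqP h0.
  have /eqP := sqr_l2norm h; rewrite h0 expr0n/= eq_sym psumr_eq0; last first.
    by move=> i _; exact: sqr_ge0.
  move/allP => hi; apply/eqP/rowP => i; rewrite mxE; apply/eqP.
  by have := hi i (mem_index_enum i); rewrite /= sqrf_eq0.
rewrite -ler_pdivrMr// -lee_fin -psiE; apply: ereal_sup_ubound.
by exists h.
Qed.

End tangent_cone_theory.

Theorem corollary5 (R : realType) :
  exists c0 : R, (0 < c0)%R /\
  forall (p n : nat), (0 < p)%N -> (0 < n)%N ->
  forall (A : set 'rV[R]_p), atom_set A ->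
  forall (M : 'rV[R]_p) (X : {linear 'rV[R]_p -> 'rV[R]_n})
    (sigma : R), (0 < sigma)%R ->
  forall (d : measure_display) (Omega : measurableType d)
    (P : probability Omega R) (Z : Omega -> 'rV[R]_n),
    isotropic_gaussian P (sigma / Num.sqrt n%:R)%R Z ->
  let K := @l2ball R p `&` tangent_cone A M in
  (c0 * sigma ^+ 2)%:E / local_upper_isometry A M X ^+ 2 *
    maxe (sudakov_estimate K / (Num.sqrt n%:R)%:E)
         (volume_ratio K / (Num.sqrt n%:R)%:E) ^+ 2
  <= minimax_risk P X Z (tangent_cone A M).
Proof.
(* The summand [1] serves the Sudakov term and the other one the volume ratio, so [D] times a bound
   on the Sudakov estimate dominates both. *)
pose D : R := (1 + 2 / Num.sqrt (ln 2))%R.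
have C0 : (0 <= 2 / Num.sqrt (ln 2) :> R)%R by rewrite divr_ge0// sqrtr_ge0.
have D0 : (0 < D)%R by rewrite /D ltr_pwDl.
have pc0 := packing_const_gt0 R.
exists (packing_const R / D ^+ 2)%R; split; first by rewrite divr_gt0// exprn_gt0.
move=> p n p0 n0 A _ M X sigma sigma0 d Omega P Z gZ.
cbv zeta; set T := tangent_cone A M; set K := @l2ball R p `&` T.
have T_cone t x : (0 <= t)%R -> T x -> T (t *: x)%R by exact: tangent_coneZ.
have T0 : T 0%R by exact: tangent_cone0.
have risk0 : 0 <= minimax_risk P X Z T by apply: minimax_risk_ge0; exists 0%R.
have sn0 : (0 < Num.sqrt n%:R :> R)%R by rewrite sqrtr_gt0 ltr0n.
pose s := (sigma / Num.sqrt n%:R)%R.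
have s0 : s != 0%R by rewrite gt_eqF// divr_gt0.
have K0 : K !=set0.
  by exists 0%R; split=> //; rewrite /l2ball/= l2norm0.
set mx := maxe _ _.
have mx0 : 0 <= mx.
  rewrite le_max; apply/orP; left; rewrite mule_ge0 ?sudakov_estimate_ge0//.
  by rewrite inve_ge0 lee_fin ltW.
have mx_le B : sudakov_estimate K <= B%:E -> mx <= (D * B / Num.sqrt n%:R)%:E.
  move=> eB; have B0 : (0 <= B)%R.
    by rewrite -lee_fin; apply: le_trans eB; exact: sudakov_estimate_ge0.
  have vB : volume_ratio K <= (2 / Num.sqrt (ln 2) * B)%:E.
    apply: le_trans (volume_ratio_le_sudakov p0 K0 _) _; first by move=> x [].
    by rewrite (EFinM (_ / _)) lee_wpmul2l.
  have nV : (Num.sqrt n%:R)%:E^-1 = (Num.sqrt n%:R)^-1%:E :> \bar R by rewrite inver gt_eqF.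
  rewrite ge_max nV EFinM !lee_wpmul2r ?lee_fin ?invr_ge0 ?(ltW sn0)//.
    apply: (le_trans vB); rewrite lee_fin ler_wpM2r// /D lerDr//.
  by apply: (le_trans eB); rewrite lee_fin ler_peMl// /D lerDl.
case riskr : (minimax_risk P X Z T) risk0 => [r||]// r0; last first.
  by rewrite leey.
rewrite lee_fin in r0.
pose q := Num.sqrt (r / (packing_const R * s ^+ 2))%R.
have sud psi : (0 < psi)%R -> (forall h, T h -> l2norm (X h) <= psi * l2norm h)%R ->
    sudakov_estimate K <= (psi * q)%:E.
  move=> psi0 Xpsi; apply: (sudakov_estimate_le_minimax s0 gZ T_cone psi0 Xpsi) => //.
  by rewrite riskr.
(* For both infinite values the inverse square is [0], and so is the left-hand side. *)
case psiE : (local_upper_isometry A M X) => [psi||]; last 2 first.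
- by rewrite expe2 mulyy invey mule0 mul0e lee_fin.
- by rewrite expe2 mulNyNy invey mule0 mul0e lee_fin.
(* The absolute value supplies a nonnegative constant; the goal depends on [psi] only through its
   square. *)
have Xpsi h : T h -> (l2norm (X h) <= `|psi| * l2norm h)%R.
  move=> Th; apply: (le_trans (local_upper_isometryP psiE Th)).
  by rewrite ler_wpM2r ?l2norm_ge0// ler_norm.
have [psi0|psi0] := eqVneq psi 0%R.
  (* [(psi ^+ 2)^-1 = +oo]: every [psi' > 0] is an admissible constant, so that
     the Sudakov estimate vanishes when the risk is finite. *)
  suff -> : mx = 0 by rewrite (expe2 0) !mule0 lee_fin.
  apply/eqP; rewrite eq_le mx0 andbT; have := mx_le 0%R; rewrite mulr0 mul0r; apply.
  apply/lee_addgt0Pr => e e0; rewrite add0e.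
  (* The admissible constant [e / (1 + q)] gives a bound of at most [e], and the added [1] covers
     [q = 0]. *)
  have q1 : (0 < 1 + q)%R by rewrite ltr_pwDl// sqrtr_ge0.
  apply: (@le_trans _ _ (e / (1 + q) * q)%:E).
    apply: sud => [|h Th]; first by rewrite divr_gt0.
    apply: (le_trans (Xpsi _ Th)); rewrite psi0 normr0 mul0r mulr_ge0 ?l2norm_ge0//.
    by rewrite divr_ge0 ?ltW.
  by rewrite lee_fin mulrAC ler_pdivrMr// ler_pM2l// lerDr.
have npsi0 : (0 < `|psi|)%R by rewrite normr_gt0.
have := mx_le _ (sud _ npsi0 Xpsi).
case: mx mx0 {mx_le} => [m||]//; rewrite !lee_fin => m0 mle.
rewrite -!EFin_expe inver sqrf_eq0 (negbTE psi0) -!EFinM lee_fin.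
apply: (@le_trans _ _ (packing_const R / D ^+ 2 * sigma ^+ 2 / psi ^+ 2 *
    (D * (`|psi| * q) / Num.sqrt n%:R) ^+ 2)%R).
  rewrite ler_wpM2l//; last first.
    by rewrite lerXn2r ?nnegrE ?(le_trans m0 mle).
  by rewrite divr_ge0 ?sqr_ge0// mulr_ge0 ?sqr_ge0// divr_ge0 ?sqr_ge0// ltW.
(* Since [q ^+ 2 = r / (packing_const R * s ^+ 2)] and [s ^+ 2 = sigma ^+ 2 / n], all factors cancel
   and leave [r]. *)
rewrite le_eqVlt; apply/orP; left; apply/eqP.
rewrite !exprMn real_normK ?num_real// sqr_sqrtr; last first.
  by rewrite divr_ge0// mulr_ge0 ?sqr_ge0// ltW.
rewrite /s; field.
by rewrite psi0 !gt_eqF.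
Qed.
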